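(* Let $X$ be a complete, connected, doubling metric space that has the discrete UWS property with constant $C$. Then every weak tangent of $X$ has at most $N$ connected components, where $N$ depends only on $C$ and on the doubling constant of $X$.
   Context: $B(x,r)$ and $\overline{B}(x,r)$ denote the open and closed metric balls. A metric space is doubling if there is a constant $D$ (the doubling constant) such that every ball of radius $r$ can be covered by at most $D$ balls of radius $r/2$. A discrete $\delta$-path in $(X,d)$ is a finite sequence $x_0,\dots,x_\ell$ of points of $X$ with $d(x_i,x_{i-1}) \le \delta$ for $1\le i\le \ell$; it is a path from $A$ to $B$ if $x_0\in A$ and $x_\ell\in B$. It intersects the $\delta'$-neighborhood of a set $K$ if $\mathrm{dist}(x_i,K)<\delta'$ for some $i$. Discrete UWS property: a doubling metric space $(X,d)$ has the discrete UWS property with constant $C\ge 1$ if for any $x\in X$ and $0<r<C^{-1}\mathrm{diam}(X)$, for every $0<\epsilon<1$, there is a finite set $K\subset B(x,2r)$, with $\#K\le C$, such that every discrete $\epsilon r$-path from $B(x,r)$ to $X\setminus\overline{B}(x,2r)$ intersects the $\epsilon r$-neighborhood of $K$. Gromov-Hausdorff convergence: pointed metric spaces $(X_n,d_n,p_n)$ converge to $(Y,d',p)$ in the Gromov-Hausdorff sense if for every $\epsilon>0$ and $R\ge 1$ there is $N_0\in\mathbb{N}$ such that for each $n\ge N_0$ there is a map $\phi_n: B(p_n,R)\to Y$ with (i) $\phi_n(p_n)=p$, (ii) $\phi_n(B(p_n,R))$ is $\epsilon$-dense in $B(p,R)$, and (iii) $|d_n(x,y)-d'(\phi_n(x),\phi_n(y))|<\epsilon$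 for all $x,y\in B(p_n,R)$. Weak tangents: for a doubling metric space $(X,d)$, a complete pointed metric space $(Y,d',p)$ is a weak tangent of $X$ if there are points $p_n\in X$ and scales $\lambda_n>0$ with $\lambda_n\to 0$ such that $(X,\lambda_n^{-1}d,p_n)$ converge in the Gromov-Hausdorff sense to $(Y,d',p)$. *)

(* Defs.v *)
From HB Require Import structures.
From mathcomp Require Import all_boot all_order all_algebra finmap.
From mathcomp Require Import all_classical all_reals ereal topology normedtype.
Import Order.TTheory GRing.Theory Num.Theory.
Import numFieldNormedType.Exports.

Set Implicit Arguments.
Unset Strict Implicit.
Unset Printing Implicit Defensive.

Local Open Scope classical_set_scope.
Local Open Scope ring_scope.

Section MetricNotions.
Context {R : realType} (X : metricType R).

(* The library's [completeType] also requires a distinguished point; this is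
   its axiom without that requirement. *)
Definition metric_complete : Prop :=
  forall F : set_system X, ProperFilter F -> cauchy F ->
    exists x : X, F --> x.

Definition diam : \bar R :=
  ereal_sup [set (mdist x y)%:E | x in [set: X] & y in [set: X]].

(* Extended-real valued, so that the distance to the empty set is +oo. *)
Definition dist_to (x : X) (K : set X) : \bar R :=
  ereal_inf [set (mdist x k)%:E | k in K].

(* This is the ball {y | d(x, y) <= r}; the library's [closed_ball] is the
   closure of the open ball, which may be smaller. *)
Definition cball (x : X) (r : R) : set X := [set y | mdist x y <= r].

Definition doubling (D : nat) : Prop :=
  forall (x : X) (r : R), 0 < r ->
    exists S : {fset X}, (#|` S| <= D)%N /\
      ball x r `<=` \bigcup_(y in [set` S]) ball y (r / 2).

(* The sequence x_0, ..., x_l is represented by its head [x0] and its tail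
   [s]; its last point is [last x0 s]. *)
Definition discrete_path (delta : R) (x0 : X) (s : seq X) : bool :=
  path (fun a b : X => mdist b a <= delta) x0 s.

Definition discrete_path_from_to (delta : R) (A B : set X)
    (x0 : X) (s : seq X) : Prop :=
  [/\ discrete_path delta x0 s, A x0 & B (last x0 s)].

Definition path_meets_nbhd (delta : R) (K : set X) (x0 : X) (s : seq X) : Prop :=
  exists2 y, y \in x0 :: s & (dist_to y K < delta%:E)%E.

Definition discrete_UWS (C : R) : Prop :=
  forall (x : X) (r : R), 0 < r -> (r%:E < C^-1%:E * diam)%E ->
  forall eps : R, 0 < eps -> eps < 1 ->
  exists K : {fset X},
    [/\ [set` K] `<=` ball x (2 * r),
        #|` K|%:R <= C &
        forall (x0 : X) (s : seq X),
          discrete_path_from_to (eps * r)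
            (ball x r) (~` cball x (2 * r)) x0 s ->
          path_meets_nbhd (eps * r) [set` K] x0 s].

End MetricNotions.

(* The metrics [d n] and [dY] are passed explicitly, so that the definition
   applies to rescalings of a fixed metric.  The values of [phi] outside the
   ball of radius [rho] are unconstrained, so a total [phi] amounts to a map
   on that ball. *)
Definition gh_cvg {R : realType} (T : nat -> Type)
    (d : forall n, T n -> T n -> R) (p : forall n, T n)
    (Y : Type) (dY : Y -> Y -> R) (q : Y) : Prop :=
  forall eps rho : R, 0 < eps -> 1 <= rho ->
  exists N0 : nat, forall n : nat, (N0 <= n)%N ->
  exists phi : T n -> Y,
    [/\ phi (p n) = q,
        forall y, dY q y < rho ->
          exists2 x, d n (p n) x < rho & dY y (phi x) < eps &
        forall x y, d n (p n) x < rho -> d n (p n) y < rho ->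
          `|d n x y - dY (phi x) (phi y)| < eps].

Definition weak_tangent {R : realType} (X Y : metricType R) (p : Y) : Prop :=
  metric_complete Y /\
  exists (pn : nat -> X) (lambda : nat -> R),
    [/\ forall n, 0 < lambda n,
        lambda n @[n --> \oo] --> (0 : R) &
        @gh_cvg R (fun=> X) (fun n x y => (lambda n)^-1 * mdist x y) pn
          Y (@mdist R Y) p].

(* Main.v *)
(* Balls of a weak tangent Y are compact, so points of Y in distinct components
   cannot be joined inside a large closed ball by discrete paths of arbitrarily
   small step.  Given n > C points in distinct components, pull them back to the
   connected space X at a scale r = R lambda_m: each is joined to the outside of
   B(p_m, 2r) by a path of small step, which must come close to the set K of the
   UWS property.  As #K <= C < n, two of these paths come close to the same
   point of K; mapped to Y, they join two of the given points by a path of small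
   step, a contradiction.  Hence N = floor(C) works. *)

Require Import Defs.
From mathcomp Require Import all_boot all_order all_algebra finmap.
From mathcomp Require Import all_classical all_reals ereal topology normedtype.
From mathcomp Require Import lra.
From Stdlib Require Import Relation_Operators.
Import Order.TTheory GRing.Theory Num.Theory.
Import numFieldNormedType.Exports.
Set Implicit Arguments.
Unset Strict Implicit.
Unset Printing Implicit Defensive.

Local Open Scope classical_set_scope.
Local Open Scope ring_scope.

(** * Counting and ultrafilters *)

Lemma not_card_le_inj (T : Type) (A : set T) (n : nat) :
  ~ (A #<= `I_n)%card ->
  exists2 f : 'I_n.+1 -> T, injective f & forall i, A (f i).
Proof.
move=> nA; have /card_leP[g] : (`I_n.+1 #<= A)%card.
  have [[m Am]|/infiniteP] := pselect (finite_set A).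
    rewrite (card_le_eqr Am) card_le_II ltnNge -(card_le_II m).
    by rewrite -(card_le_eql Am); apply/negP.
  exact/card_le_trans/subset_card_le.
pose h (i : 'I_n.+1) := g (SigSub (mem_set (ltn_ord i : `I_n.+1 i))).
exists (set_val \o h) => [i j|i].
  by move=> /val_inj /(in2TT (@inj _ _ _ g)) /(congr1 set_val) /= /ord_inj.
exact/set_mem/valP.
Qed.

(** If an ultrafilter contained no [A i], it would contain all the complements, hence their finite
    intersection. This later turns total boundedness into Cauchyness. *)
Lemma ultra_bigcup (T : Type) (I : choiceType) (F : set_system T)
    (S : set I) (A : I -> set T) :
  UltraFilter F -> finite_set S -> F (\bigcup_(i in S) A i) ->
  exists2 i, S i & F (A i).
Proof.
move=> FU /finite_fsetP[S' ->] FA; apply: contrapT => /forall2NP nA.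
have FnA : F (\bigcap_(i in [set` S']) ~` A i).
  apply: filter_bigI => i iS; have [//|nFA] := nA i.
  by have [/nFA|] := in_ultra_setVsetC (A i) FU.
have [z [[i iS Az] nAz]] := filter_ex (filterI FA FnA).
exact: nAz i iS Az.
Qed.

(** * Chains of small steps, connectedness and total boundedness *)

Section Chains.
Context {R : realType} {X : metricType R}.
Implicit Types (U : set X) (d : R).

Definition small_step U d (x y : X) : Prop := [/\ U x, U y & mdist x y <= d].

(** As an equivalence closure, chains can be reversed and concatenated freely; [U] confines every
    step, while reflexivity holds off [U] as well. *)
Definition chained U d : X -> X -> Prop :=
  clos_refl_sym_trans X (small_step U d).

Lemma chained_le U d d' x y : d <= d' -> chained U d x y -> chained U d' x y.
Proof.
move=> dd'; elim=> [a b [Ua Ub ab]|a|a b _ ab|a b c _ ab _ bc].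
- by apply: rst_step; split=> //; exact: le_trans dd'.
- exact: rst_refl.
- exact: rst_sym.
- exact: rst_trans ab bc.
Qed.

(** If no step reachable from [x] left [V], membership in [V] would be constant along the chain, by
    induction on the closure. *)
Lemma chained_exit U d (V : set X) x y : chained U d x y -> V x -> ~ V y ->
  exists u v, [/\ chained U d x u, U u, mdist u v <= d, V u & ~ V v].
Proof.
move=> xy Vx nVy; apply: contrapT => noexit.
suff VE a b : chained U d a b -> chained U d x a -> (V a <-> V b).
  by apply: nVy; apply/(VE _ _ xy) => //; exact: rst_refl.
elim=> {y a b xy nVy} [a b [Ua Ub ab] xa|//|a b ab IH xb|a b c ab IH1 _ IH2 xa].
- split=> [Va|Vb]; apply: contrapT => nV; apply: noexit.
    by exists a, b; split.
  exists b, a; split=> //; last by rewrite metric_sym.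
  by apply: rst_trans xa _; apply: rst_step; split.
- by apply: iff_sym; apply: IH; exact: rst_trans xb (rst_sym _ _ _ _ ab).
- by rewrite IH1 // IH2 //; exact: rst_trans xa ab.
Qed.

Lemma closed_cball (x : X) d : closed (cball x d).
Proof.
move=> y cy; apply/ler_addgt0Pr => e e0.
have [z [xz]] := cy _ (nbhsx_ballx y e e0).
rewrite ballEmdist /= => yz.
by rewrite (le_trans (metric_triangle x z y))// lerD// ltW// metric_sym.
Qed.

(** The set [Q] of points chained to [x] in [U] at every scale is connected. Otherwise two disjoint
    open sets [V], [V'] separate it; chains from one piece to the other leave [V] at points that
    cluster, by compactness, at a point of [Q], and that point has no place in either piece. *)
Lemma compact_chained_component U x y : compact U -> U x -> U y ->
  (forall d, 0 < d -> chained U d x y) -> connected_component setT x y.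
Proof.
move=> cU Ux Uy xy.
have clU : closed U := compact_closed (@metric_hausdorff _ X) cU.
pose Q := [set z | U z /\ forall d, 0 < d -> chained U d x z].
exists Q; last by [].
split=> //; first by split=> // d _; exact: rst_refl.
have clQ : closed Q.
  move=> z cz; have Uz : U z by apply: clU; apply: closureS cz => ? [].
  split=> // d d0; have [w [[Uw xw]]] := cz _ (nbhsx_ballx z d d0).
  rewrite ballEmdist /= => /ltW zw.
  apply: rst_trans (xw d d0) _; apply: rst_step; split=> //.
  by rewrite metric_sym.
move=> B [b Bb] [O oO BO] [C clC BC].
have clB : closed B by rewrite BC; exact: closedI.
(* As [B] is [Q] intersected with [O], this set is the rest of [Q]. *)
have clB' : closed (Q `&` ~` O) by apply: closedI => //; exact: open_closedC.
apply: contrapT => BQ.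
have [q Qq nBq] : exists2 q, Q q & ~ B q.
  apply: contrapT => /forall2NP nq; apply: BQ; apply/seteqP; split.
    by rewrite BO => ? [].
  by move=> z Qz; have [|/contrapT] := nq z.
have BB' : B `&` (Q `&` ~` O) = set0.
  by rewrite BO -subset0 => z [[_ Oz] []].
have [V [V' [oV oV' BV BV' VV']]] :=
  (@normal_openP R X).1 pseudometric_normal B (Q `&` ~` O) clB clB' BB'.
(* The points from which a step of size [d] leaves [V]. These sets shrink with [d] and generate the
   filter [F]. *)
pose W d := [set u | [/\ U u, V u, chained U d x u &
  exists2 v, ~ V v & mdist u v <= d]].
have W0 d : 0 < d -> W d !=set0.
  move=> d0.
  have [_ /(_ d d0) xb] : Q b by move: Bb; rewrite BO => -[].
  have bq : chained U d b q.
    by apply: rst_trans (rst_sym _ _ _ _ xb) _; apply: Qq.2.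
  have nVq : ~ V q.
    move=> Vq; have : (V `&` V') q.
      split=> //; apply: BV'; split; first exact: Qq.
      by move=> Oq; apply: nBq; rewrite BO.
    by rewrite VV'.
  have [u [v [bu Uu uv Vu nVv]]] := chained_exit bq (BV _ Bb) nVq.
  exists u; split=> //; last by exists v.
  exact: rst_trans xb bu.
pose F := filter_from [set d : R | 0 < d] W.
have FF : ProperFilter F.
  have W_le d e : d <= e -> W d `<=` W e.
    move=> de u [Uu Vu xu [v nVv uv]]; split=> //; first exact: chained_le xu.
    by exists v => //; exact: le_trans de.
  apply: filter_from_proper => //.
  apply: filter_from_filter; first by exists 1 => /=.
  move=> d e /= d0 e0; exists (Num.min d e) => /=; first by rewrite lt_min d0.
  by rewrite subsetI; split; apply: W_le; rewrite ge_min lexx ?orbT.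
have [|z [Uz Fz]] := cU F FF; first by exists 1 => //= u [].
have near_z d : 0 < d -> exists2 u, W d u & mdist z u < d.
  move=> d0; have FW : F (W d) by exists d.
  have [u [Wu]] := Fz _ _ FW (nbhsx_ballx z d d0).
  by rewrite ballEmdist /=; exists u.
have Qz : Q z.
  split=> // d d0; have [u [Uu _ xu _] zu] := near_z d d0.
  by apply: rst_trans xu _; apply: rst_step; split; rewrite // metric_sym ltW.
(* Arbitrarily close to [z] there are points [u] in [V] and points [v] outside [V]: the latter
   exclude [z] from [V], the former from [V']. *)
have nVz : ~ V z.
  move=> Vz; have /nbhs_ballP[e /= e0] : nbhs z V by exact: open_nbhs_nbhs.
  rewrite ballEmdist => zV.
  have [|u [_ _ _ [v nVv uv]] zu] := near_z (e / 2); first by rewrite divr_gt0.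
  apply: nVv; apply: zV => /=; have := metric_triangle z u v; lra.
have V'z : V' z.
  by apply: BV'; split=> // Oz; apply: nVz; apply: BV; rewrite BO.
have /nbhs_ballP[e /= e0] : nbhs z V' by exact: open_nbhs_nbhs.
rewrite ballEmdist => zV'.
have [u [_ Vu _ _] zu] := near_z e e0.
have : (V `&` V') u by split=> //; exact: zV'.
by rewrite VV'.
Qed.

(** Otherwise the points reached by [d]-paths inside [U] form a nonempty clopen set, hence all of
    [X], although [z] is outside [U]. *)
Lemma connected_exit_path d U x z : connected [set: X] -> 0 < d ->
  U x -> ~ U z ->
  exists s w, [/\ discrete_path d x (rcons s w),
    {in x :: s, forall y, U y} & ~ U w].
Proof.
move=> cX d0 Ux nUz; apply: contrapT => noexit.
pose B := [set y | exists s, [/\ discrete_path d x s,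
  {in x :: s, forall y, U y} & last x s = y]].
have Bstep a b : B a -> mdist b a <= d -> B b.
  move=> [s [xs Us sa]] ba; exists (rcons s b).
  have xsb : discrete_path d x (rcons s b).
    by rewrite /discrete_path rcons_path sa ba andbT.
  split=> //; last by rewrite last_rcons.
  move=> y; rewrite -rcons_cons mem_rcons inE => /predU1P[->|/Us//].
  by apply: contrapT => nUb; apply: noexit; exists s, b.
suff BT : B = setT.
  have [s [_ Us sz]] : B z by rewrite BT.
  by apply: nUz; apply: Us; rewrite -sz mem_last.
apply: cX.
- by exists x, [::]; split=> // y; rewrite inE => /eqP ->.
- exists B; rewrite ?setTI //; rewrite openE => a Ba.
  apply/nbhs_ballP; exists d => //= b; rewrite ballEmdist /= => ab.
  by apply: Bstep Ba _; rewrite metric_sym ltW.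
- exists B; rewrite ?setTI // => a ca.
  have [b [Bb]] := ca _ (nbhsx_ballx a d d0).
  by rewrite ballEmdist /= => /ltW; exact: Bstep.
Qed.

Lemma doubling_totally_bounded (D : nat) (x : X) (r e : R) :
  doubling X D -> 0 < r -> 0 < e ->
  exists2 S : set X, finite_set S & ball x r `<=` \bigcup_(y in S) ball y e.
Proof.
move=> dX r0 e0.
have halving k : exists2 S : set X, finite_set S &
    ball x r `<=` \bigcup_(y in S) ball y (r / 2 ^+ k).
  elim: k => [|k [S finS SE]].
    by exists [set x] => //; rewrite bigcup_set1 expr0 divr1.
  have rk0 : 0 < r / 2 ^+ k by rewrite divr_gt0// exprn_gt0.
  have /choice[T TE] y : exists T : {fset X},
      ball y (r / 2 ^+ k) `<=` \bigcup_(z in [set` T]) ball z (r / 2 ^+ k.+1).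
    have [T [_ TE]] := dX y _ rk0; exists T.
    by rewrite exprSr invfM mulrA.
  exists (\bigcup_(y in S) [set` T y]); first exact: bigcup_finite.
  move=> z /SE [y Sy] /TE [w Tw zw]; by exists w => //; exists y.
(* With k = floor(r / e), one has r / e < k + 1 <= 2^k, so k halvings suffice. *)
have [S finS SE] := halving (Num.truncn (r / e)); exists S => //.
move=> z /SE [y Sy yz]; exists y => //; apply: le_ball yz.
rewrite ler_pdivrMr ?exprn_gt0// mulrC -ler_pdivrMr//.
apply: (le_trans (ltW (truncnS_gt _))).
by rewrite -natrX ler_nat ltn_expl.
Qed.

End Chains.

(** Here [P] stands for the region where [f], an approximate isometry, is controlled. *)
Lemma chained_path (R : realType) (X Y : metricType R) (P : set X) (V : set Y)
    (d e : R) (f : X -> Y) (x : X) (s : seq X) :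
  (forall a b, P a -> P b -> mdist b a <= d -> small_step V e (f a) (f b)) ->
  discrete_path d x s -> {in x :: s, forall z, P z} ->
  {in x :: s, forall z, chained V e (f x) (f z)}.
Proof.
move=> step; elim: s x => [|a s IH] x /=.
  by move=> _ _ z; rewrite inE => /eqP ->; exact: rst_refl.
move=> /andP[xa sa] Ps z; rewrite inE => /predU1P[->|zs]; first exact: rst_refl.
apply: (@rst_trans _ _ _ (f a)).
  by apply/rst_step/step => //; apply: Ps; rewrite !inE eqxx ?orbT.
by apply: IH => // w ws; apply: Ps; rewrite inE ws orbT.
Qed.

(** * Compact balls and chains in weak tangents *)

Section WeakTangents.
Context {R : realType} {X Y : metricType R}.
Variable p : Y.

(** The ball is complete and inherits total boundedness from [X] through the approximations, so
    every ultrafilter on it is Cauchy and converges. *)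
Lemma weak_tangent_compact_cball (D : nat) (rho : R) :
  doubling X D -> weak_tangent X p -> compact (cball p rho).
Proof.
move=> dX [cY [pn [lam [lam0 _ gh]]]].
rewrite compact_ultra => F FU Fp.
suff /cY[y Fy] : cauchy F.
  exists y; split=> //; apply: closed_cball.
  move=> A /Fy FA; have FpA : F (cball p rho `&` A) by exact: filterI.
  exact: filter_ex FpA.
apply/cauchy_exP => e e0.
(* [r] exceeds [rho], so the open [r]-ball contains the closed ball. Two points of one piece [A s]
   differ by less than 5h: h at each end for density, h for the distortion and 2h inside a ball of
   [X]. *)
pose r := Num.max 1 (rho + 1); pose h := e / 5.
have h0 : 0 < h by rewrite divr_gt0.
have r1 : 1 <= r by rewrite le_max lexx.
have r0 : 0 < r := lt_le_trans ltr01 r1.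
have [N /(_ N (leqnn N))[phi [_ dense isom]]] := gh h r h0 r1.
have lN := lam0 N.
have [S finS SE] := @doubling_totally_bounded _ _ D (pn N) (lam N * r)
  (lam N * h) dX (mulr_gt0 lN r0) (mulr_gt0 lN h0).
pose A s := [set y | exists x, [/\ mdist (pn N) x < lam N * r,
   mdist s x < lam N * h & mdist y (phi x) < h]].
have [||s _ FAs] := @ultra_bigcup _ _ F S A => //.
  apply: filterS Fp => y py.
  have [|x] := dense y.
    by rewrite (le_lt_trans py)// lt_max ltrDl ltr01 orbT.
  rewrite ltr_pdivrMl// => px yx.
  have [s Ss] : (\bigcup_(y in S) ball y (lam N * h)) x.
    by apply: SE; rewrite ballEmdist.
  by rewrite ballEmdist => sx; exists s => //; exists x.
have [y [x [px sx yx]]] := filter_ex FAs.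
exists y; apply: filterS FAs => z [w [pw sw zw]]; rewrite ballEmdist /=.
have := isom x w; rewrite !ltr_pdivrMl// => /(_ px pw).
rewrite ltr_distlC => /andP[_].
have : (lam N)^-1 * mdist x w < h + h.
  rewrite ltr_pdivrMl// mulrDr (le_lt_trans (metric_triangle x s w))//.
  by rewrite ltrD// metric_sym.
have := metric_triangle y (phi x) z; have := metric_triangle (phi x) (phi w) z.
rewrite (metric_sym (phi w) z); have : 5 * h = e by rewrite /h; lra.
by lra.
Qed.

Lemma weak_tangent_chained (C : R) (n : nat) (y : 'I_n -> Y) (r d : R) :
  connected [set: X] -> discrete_UWS X C -> weak_tangent X p ->
  1 <= C -> C < n%:R -> injective y -> 1 <= r -> 0 < d -> d <= 1 / 2 ->
  (forall i, mdist p (y i) + 1 <= r) ->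
  exists i j, i <> j /\ chained (cball p (4 * r)) (2 * d) (y i) (y j).
Proof.
move=> cX uX [_ [pn [lam [lam0 lam_cvg gh]]]] C1 Cn y_inj r1 d0 d2 yr.
have r0 : 0 < r by lra.
have C0 : 0 < C by lra.
have n1 : (1 < n)%N by rewrite -(ltr_nat R); lra.
(* Two distinct points of [X] bound its diameter from below. If [X] had only one point, its image
   would be within half of their distance of both [y i0] and [y i1]. *)
have [a [b ab]] : exists a b : X, 0 < mdist a b.
  pose i0 : 'I_n := Ordinal (ltnW n1); pose i1 : 'I_n := Ordinal n1.
  have D0 : 0 < mdist (y i0) (y i1) by rewrite mdist_gt0 (inj_eq y_inj).
  have [||N /(_ N (leqnn N))[phi [_ dense isom]]] :=
    gh (mdist (y i0) (y i1) / 2) r _ _ => //; first by rewrite divr_gt0.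
  have [|x0 _ yx0] := dense (y i0); first by have := yr i0; lra.
  have [|x1 _ yx1] := dense (y i1); first by have := yr i1; lra.
  exists x0, x1; rewrite mdist_gt0; apply/eqP => x01.
  have := metric_triangle (y i0) (phi x0) (y i1).
  rewrite (metric_sym (phi x0)) {2}x01; lra.
(* Radius [3 * r] leaves room for the last point of a path, which overshoots the ball of radius
   [2 * r] by one step. *)
have [N gN] : exists N, forall n, (N <= n)%N -> exists phi : X -> Y,
    [/\ phi (pn n) = p,
        forall y, mdist p y < 3 * r ->
          exists2 x, (lam n)^-1 * mdist (pn n) x < 3 * r & mdist y (phi x) < d &
        forall x y, (lam n)^-1 * mdist (pn n) x < 3 * r ->
          (lam n)^-1 * mdist (pn n) y < 3 * r ->
          `|(lam n)^-1 * mdist x y - mdist (phi x) (phi y)| < d].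
  by apply: gh => //; lra.
(* This makes [r * lam m] an admissible scale for the UWS property, and keeps [a] and [b] from both
   lying in a ball of radius [2 * (r * lam m)]. *)
have [m Nm lm] : exists2 m, (N <= m)%N & lam m < mdist a b / (4 * C * r).
  have /cvgrPdist_lt/(_ (mdist a b / (4 * C * r))) := lam_cvg.
  rewrite divr_gt0 ?mulr_gt0// => /(_ isT) [M _ /= HM].
  exists (maxn N M); first exact: leq_maxl.
  by have := HM _ (leq_maxr N M); rewrite sub0r normrN gtr0_norm.
have [phi [phip dense isom]] := gN m Nm.
have {gN gh lam_cvg N Nm} l0 := lam0 m.
set l := lam m in lm dense isom l0; set q := pn m in phip dense isom.
have Clr : C * (r * l) < mdist a b / 4.
  move: lm; rewrite ltr_pdivlMr ?mulr_gt0//; lra.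
have rl0 : 0 < r * l by rewrite mulr_gt0.
have rl_small : r * l < mdist a b / 4.
  by rewrite (le_lt_trans _ Clr)// ler_peMl// ltW.
have scale t s : (l^-1 * t < s) = (t < s * l) by rewrite ltr_pdivrMl// mulrC.
have scale_le t s : (l^-1 * t <= s) = (t <= s * l).
  by rewrite ler_pdivrMl// mulrC.
have [z qz] : exists z, ~ cball q (2 * (r * l)) z.
  apply: contrapT => /forallNP near_q.
  have /contrapT := near_q a; have /contrapT := near_q b.
  rewrite /cball /=; have := metric_triangle a q b.
  rewrite (metric_sym a q); lra.
(* With eps = d / r, steps in [X] have size [d * l], that is [d] after rescaling; the distortion
   makes them at most [2 * d] in [Y]. *)
have [||||K [Kq KC Kmeet]] := uX q (r * l) _ _ (d / r) => //.
- apply: (@lt_le_trans _ _ (C^-1%:E * (mdist a b)%:E)%E).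
    rewrite -EFinM lte_fin ltr_pdivlMl//; lra.
  rewrite lee_pmul2l// ?lte_fin ?invr_gt0//.
  by apply: ereal_sup_ubound; exists a => //; exists b.
- by rewrite divr_gt0.
- rewrite ltr_pdivrMr//; lra.
have epsr : d / r * (r * l) = d * l by rewrite mulrA divfK// gt_eqF.
rewrite epsr in Kmeet.
pose P := [set x | l^-1 * mdist q x < 3 * r].
have Pcball w : P w -> cball p (4 * r) (phi w).
  move=> Pw; have Pq : P q by rewrite /P /= mdistxx mulr0; lra.
  have := isom q w Pq Pw; rewrite phip ltr_distlC => /andP[_].
  move: Pw; rewrite /P /cball /=; lra.
have stepP u v : P u -> P v -> mdist v u <= d * l ->
    small_step (cball p (4 * r)) (2 * d) (phi u) (phi v).
  move=> Pu Pv; rewrite -scale_le metric_sym => uv.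
  split; [exact: Pcball|exact: Pcball|].
  have := isom u v Pu Pv; rewrite ltr_distlC => /andP[_]; lra.
have near_y i : exists k,
    k \in K /\ chained (cball p (4 * r)) (2 * d) (y i) (phi k).
  have [|x Px yx] := dense (y i); first by have := yr i; lra.
  (* The unit margin in [yr] absorbs the two errors, each below d <= 1/2. *)
  have qx : mdist q x < r * l.
    have Pq : P q by rewrite /P /= mdistxx mulr0; lra.
    have := isom q x Pq Px; rewrite phip ltr_distlC => /andP[].
    rewrite -scale; have := metric_triangle p (y i) (phi x); have := yr i; lra.
  have [|s [w [xw sq nw]]] := @connected_exit_path _ _ (d * l)
    (cball q (2 * (r * l))) x z cX (mulr_gt0 d0 l0) _ qz.
    by rewrite /cball /=; lra.
  have [|v vs] := Kmeet x (rcons s w).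
    by split=> //; [rewrite ballEmdist|rewrite last_rcons].
  move=> /ereal_inf_lt[_ [k Kk <-]]; rewrite lte_fin => vk.
  have dl : d * l < r * l by rewrite ltr_pM2r//; lra.
  have Pball u : mdist q u < 3 * (r * l) -> P u by rewrite /P /= scale mulrA.
  have Ps : {in x :: rcons s w, forall u, P u}.
    move=> u us; apply: Pball; move: us.
    rewrite -rcons_cons mem_rcons inE => /predU1P[->|/sq]; last first.
      by rewrite /cball /=; lra.
    move: xw; rewrite /discrete_path rcons_path => /andP[_].
    have := sq _ (mem_last x s); rewrite /cball /=.
    have := metric_triangle q (last x s) w; rewrite (metric_sym w); lra.
  exists k; split=> //.
  have Pk : P k by apply: Pball; have := Kq k Kk; rewrite ballEmdist /=; lra.
  apply: (@rst_trans _ _ _ (phi x)).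
    apply: rst_step; split; [|exact: Pcball|lra].
    by rewrite /cball /=; have := yr i; lra.
  apply: (@rst_trans _ _ _ (phi v)).
    by apply: (chained_path stepP xw).
  apply: rst_step; apply: stepP => //; first exact: Ps.
  by rewrite metric_sym ltW.
have /choice[k kP] := near_y.
(* Pigeonhole: [K] has at most C < n points. *)
have /injectivePn[i [j ij kij]] : ~~ injectiveb k.
  apply/negP => /injectiveP k_inj.
  have : (n <= #|` K|)%N.
    rewrite -(size_enum_ord n) -(size_map k) uniq_leq_size//.
      by rewrite map_inj_uniq ?enum_uniq.
    by move=> _ /mapP[i _ ->]; have [] := kP i.
  by rewrite -(ler_nat R) leNgt (le_lt_trans KC Cn).
exists i, j; split; first exact/eqP.
have [[_ yi] [_ yj]] := (kP i, kP j).
by apply: rst_trans yi _; rewrite kij; exact: rst_sym.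
Qed.

End WeakTangents.

(** * Bounding the number of components *)

Theorem proposition1p5 (R : realType) (C : R) (D : nat) (hC : 1 <= C) :
  exists N : nat,
    forall X : metricType R,
      metric_complete X -> connected [set: X] -> doubling X D ->
      discrete_UWS X C ->
      forall (Y : metricType R) (p : Y), weak_tangent X p ->
        (range (connected_component [set: Y]) #<= `I_N)%card.
Proof.
exists (Num.truncn C) => X _ cX dX uX Y p tY; apply: contrapT.
move=> /not_card_le_inj[f f_inj fE].
have /choice[y yE] i : exists z, connected_component [set: Y] z = f i.
  by have [z _ zf] := fE i; exists z.
have y_inj : injective y by move=> i j ij; apply: f_inj; rewrite -!yE ij.
pose r := \sum_i mdist p (y i) + 1.
have yr i : mdist p (y i) + 1 <= r.
  rewrite lerD2r (bigD1 i)//= lerDl sumr_ge0// => j _; exact: mdist_ge0.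
have r1 : 1 <= r by rewrite lerDr sumr_ge0// => j _; exact: mdist_ge0.
have cY := weak_tangent_compact_cball (rho := 4 * r) dX tY.
have yU i : cball p (4 * r) (y i) by rewrite /cball /=; have := yr i; lra.
(* Failing to be chained persists at smaller scales, so one [d] serves all of the finitely many
   pairs. *)
have sep i j : \forall d \near 0^'+, i <> j ->
    ~ chained (cball p (4 * r)) d (y i) (y j).
  have [->|/eqP ij] := eqVneq i j; first by near=> d.
  have [d d0 nd] : exists2 d,
      0 < d & ~ chained (cball p (4 * r)) d (y i) (y j).
    apply: contrapT => /forall2NP all_chained; apply: ij; apply: f_inj.
    rewrite -!yE; apply: same_connected_component.
    apply: (compact_chained_component cY) => // d d0.
    by have [|/contrapT] := all_chained d.
  near=> e => _ ye; apply: nd; apply: chained_le ye.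
  by near: e; exact: nbhs_right_le.
have /filter_ex[d [[d0 d1] dsep]] : \forall d \near (0 : R)^'+,
    (0 < d /\ d <= 1) /\
    forall i j, i <> j -> ~ chained (cball p (4 * r)) d (y i) (y j).
  near=> d; split.
    by split; near: d; [exact: nbhs_right_gt|exact: nbhs_right_le].
  by near: d; apply: filter_forall => i; apply: filter_forall => j; exact: sep.
(* Halving [d] compensates for the doubled step in the lemma and meets its bound 1/2. *)
have [|||i [j [ij yij]]] := weak_tangent_chained (d := d / 2)
  cX uX tY hC (truncnS_gt C) y_inj r1 => //; try lra.
by apply: dsep ij _; move: yij; rewrite [2 * (d / 2)]mulrC divfK.
Unshelve. all: by end_near. Qed.
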